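(* For every $n\geq 3$ we have $\lfloor\frac{3}{2}n\rfloor\leq\widetilde{g}_s^s(n)\leq 2n-2$. Equivalently, the largest cardinality of a strictly convex set $X\subseteq A+A=\{a+a'\mid a,a'\in A\}$, where $A$ ranges over strictly convex sets of $n$ points in the plane, lies between $\lfloor\frac{3}{2}n\rfloor$ and $2n-2$.
   Context: A finite point set $X\subseteq\mathbb{R}^2$ is strictly convex if every point of $X$ is a vertex of its convex hull. A drawing of a graph is a map of its vertices to $\mathbb{R}^2$, edges drawn as straight segments, such that no two vertices coincide, no two edge midpoints coincide, and no edge midpoint coincides with a vertex. $\widetilde{g}_s^s(n)$ is the maximum of $m+n'$ over all $n$-vertex graphs $G$ with $m$ edges, all drawings of $G$ whose vertex set and set of edge midpoints are both strictly convex, and all sets $S$ of $n'$ vertices of $G$ such that the set of edge midpoints together with (the positions of) the vertices in $S$ is strictly convex. *)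

(* Defs.v *)
From HB Require Import structures.
From mathcomp Require Import all_boot all_order all_algebra finmap.
From mathcomp Require Import all_classical all_reals all_analysis.

Set Implicit Arguments.
Unset Strict Implicit.
Unset Printing Implicit Defensive.

Import Order.TTheory GRing.Theory Num.Theory.

Local Open Scope classical_set_scope.
Local Open Scope ring_scope.

Definition convex_hull (R : realType) (X : set 'rV[R]_2) : set 'rV[R]_2 :=
  smallest (@convex_set R 'rV[R]_2) X.

(* The vertices of a convex polygon (possibly degenerate: a segment or a point)
   are its extreme points. *)
Definition is_vertex (R : realType) (K : set 'rV[R]_2) (x : 'rV[R]_2) : Prop :=
  K x /\ forall (y z : 'rV[R]_2) (t : R), K y -> K z -> 0 < t < 1 ->
    x = t *: y + (1 - t) *: z -> y = x /\ z = x.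

Definition strictly_convex (R : realType) (X : set 'rV[R]_2) : Prop :=
  finite_set X /\ forall x, X x -> is_vertex (convex_hull X) x.

(* A simple graph on the vertex set 'I_n is given by its set of edges, each edge
   being a set of two vertices. *)
Definition is_graph (n : nat) (E : {set {set 'I_n}}) : Prop :=
  forall e, e \in E -> #|e| = 2%N.

(* For an edge e = {u, v} this is (p u + p v) / 2. *)
Definition midpoint (R : realType) (n : nat) (p : 'I_n -> 'rV[R]_2)
    (e : {set 'I_n}) : 'rV[R]_2 :=
  2^-1 *: \sum_(v in e) p v.

Definition edge_midpoints (R : realType) (n : nat) (p : 'I_n -> 'rV[R]_2)
    (E : {set {set 'I_n}}) : set 'rV[R]_2 :=
  [set midpoint p e | e in [set` E]].

Definition is_drawing (R : realType) (n : nat) (E : {set {set 'I_n}})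
    (p : 'I_n -> 'rV[R]_2) : Prop :=
  [/\ injective p,
      {in E &, injective (midpoint p)}
    & forall e v, e \in E -> midpoint p e <> p v].

Definition admissible (R : realType) (n : nat) (E : {set {set 'I_n}})
    (S : {set 'I_n}) : Prop :=
  is_graph E /\
  exists p : 'I_n -> 'rV[R]_2,
    [/\ is_drawing E p,
        strictly_convex (range p),
        strictly_convex (edge_midpoints p E)
      & strictly_convex (edge_midpoints p E `|` p @` [set` S])].

(* There are finitely many pairs (E, S), so this is a maximum over a finite
   type; the pair (set0, set0) is admissible, so the default value 0 of \max
   plays no role. *)
Definition gtilde_ss (R : realType) (n : nat) : nat :=
  (\max_(ES : {set {set 'I_n}} * {set 'I_n} | `[< admissible R ES.1 ES.2 >])
     (#|ES.1| + #|ES.2|))%N.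

Definition sumset (R : realType) (A : set 'rV[R]_2) : set 'rV[R]_2 :=
  [set a + a' | a in A & a' in A].

Definition convex_sumset_card (R : realType) (n k : nat) : Prop :=
  exists A X : {fset 'rV[R]_2},
    [/\ strictly_convex [set` A], #|` A|%fset = n,
        strictly_convex [set` X], [set` X] `<=` sumset [set` A]
      & #|` X|%fset = k].

Definition is_largest (P : nat -> Prop) (k : nat) : Prop :=
  P k /\ forall j, P j -> (j <= k)%N.

(* Main.v *)
Require Import Defs.
From mathcomp Require Import all_boot all_order all_algebra finmap.
From mathcomp Require Import all_classical all_reals all_analysis.
From mathcomp Require Import ring lra zify.

(* Upper bound.  If the edge uv has, at u, edges of the graph on both of its
   sides, then the hull of the midpoints meets the segment from u to the
   midpoint of uv before that midpoint; the same happens if u is in S.  Hence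
   every edge is angularly first or last at one of its ends, this end can be
   taken outside S, and no edge joins two vertices of S.  Each vertex has one
   first and one last edge, so there are at most 2(n - |S|) edges.  The missing
   units for |S| <= 1 come from edges that are extreme at both ends: unless the
   graph is a star centred at s, some such edge avoids s.

   Lower bound.  In a convex polygon, take the midpoints of the n sides and
   every other vertex; here the polygon is inscribed in a parabola.

   The sumset form is the drawing form scaled by 2. *)

Set Implicit Arguments.
Unset Strict Implicit.
Unset Printing Implicit Defensive.

Import Order.TTheory GRing.Theory Num.Theory.

Local Open Scope classical_set_scope.
Local Open Scope ring_scope.

(** * Convex hulls and strictly convex position *)

Section ConvexPosition.
Variable R : realType.
Implicit Types (X Y K : set 'rV[R]_2) (x y z : 'rV[R]_2).

Lemma rowv2P x y : x 0 0 = y 0 0 -> x 0 1 = y 0 1 -> x = y.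
Proof.
move=> h0 h1; apply/rowP => i; case: i => [[|[|//]]] hi.
  by rewrite (_ : Ordinal hi = 0) //; apply: val_inj.
by rewrite (_ : Ordinal hi = 1) //; apply: val_inj.
Qed.

Lemma convex_setE K : @convex_set R 'rV[R]_2 K <->
  forall x y (t : R), K x -> K y -> 0 <= t <= 1 -> K (t *: x + (1 - t) *: y).
Proof.
split=> [cK x y t Kx Ky /andP[t0 t1]|h x y t /set_mem Kx /set_mem Ky].
  have := cK x y (Itv01 t0 t1); rewrite !inE; exact.
apply/mem_set; apply: h => //.
by apply/andP.
Qed.

Lemma convex_hull_convex X x y (t : R) : convex_hull X x -> convex_hull X y ->
  0 <= t <= 1 -> convex_hull X (t *: x + (1 - t) *: y).
Proof.
move=> hx hy ht C [cC XC].
by apply: (convex_setE C).1 => //; [apply: hx|apply: hy].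
Qed.

Lemma convex_hull_sub X : X `<=` convex_hull X.
Proof. exact: sub_gen_smallest. Qed.

Lemma convex_hull_mono X Y : X `<=` Y -> convex_hull X `<=` convex_hull Y.
Proof.
move=> XY; apply: smallest_sub => [|x /XY]; last exact: convex_hull_sub.
by apply/convex_setE; exact: convex_hull_convex.
Qed.

Lemma strictly_convex_sub X Y : X `<=` Y -> strictly_convex Y ->
  strictly_convex X.
Proof.
move=> XY [fY eY]; split; first exact: sub_finite_set XY fY.
move=> x Xx; have [_ ext] := eY _ (XY _ Xx); split; first exact: convex_hull_sub.
by move=> y z t hy hz; apply: ext; apply: (convex_hull_mono XY).
Qed.

(** Dividing by [c] maps the hull of the scaled set into the hull of [X], so extremality pulls
    back. *)
Lemma strictly_convex_scale (c : R) X : c != 0 -> strictly_convex X ->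
  strictly_convex [set c *: x | x in X].
Proof.
move=> c0 [fX eX]; split; first exact: finite_image.
have sub y : convex_hull [set c *: x | x in X] y -> convex_hull X (c^-1 *: y).
  move: y; apply: smallest_sub => /=; last first.
    by move=> _ [x Xx <-] /=; rewrite scalerK //; exact: convex_hull_sub.
  apply/convex_setE => y z t hy hz ht /=.
  rewrite scalerDr !scalerA ![c^-1 * _]mulrC -!scalerA.
  exact: convex_hull_convex.
move=> _ [x Xx <-]; split; first by apply: convex_hull_sub; exists x.
move=> y z t /sub hy /sub hz ht e; have [_ ext] := eX _ Xx.
have [|yx zx] := ext _ _ _ hy hz ht; last first.
  by split; [rewrite -yx|rewrite -zx]; rewrite scalerA divff // scale1r.
by rewrite -[x](scalerK c0) e scalerDr !scalerA ![c^-1 * _]mulrC.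
Qed.

(* The points strictly above the supporting line at [x], together with [x],
   form a convex set containing [X]. *)
Lemma strictly_convex_support X : finite_set X ->
  (forall x, X x -> exists a b : R, forall y, X y -> y != x ->
     a * x 0 0 + b * x 0 1 < a * y 0 0 + b * y 0 1) ->
  strictly_convex X.
Proof.
move=> fX sX; split=> // x Xx; have [a [b hab]] := sX _ Xx.
pose K := [set y | y = x \/
  a * x 0 0 + b * x 0 1 < a * y 0 0 + b * y 0 1].
have val y z (t : R) : a * (t *: y + (1 - t) *: z) 0 0
    + b * (t *: y + (1 - t) *: z) 0 1
  = t * (a * y 0 0 + b * y 0 1) + (1 - t) * (a * z 0 0 + b * z 0 1).
  by rewrite !mxE; ring.
have hK : convex_hull X `<=` K.
  apply: smallest_sub => [|y Xy]; last first.
    by have [->|yx] := eqVneq y x; [left|right; exact: hab].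
  apply/convex_setE => y z t Ky Kz /andP[t0 t1].
  have [->|tn0] := eqVneq t 0; first by rewrite scale0r add0r subr0 scale1r.
  have [->|tn1] := eqVneq t 1; first by rewrite subrr scale0r addr0 scale1r.
  have tp : 0 < t by rewrite lt_neqAle eq_sym tn0.
  have tp1 : 0 < 1 - t by rewrite subr_gt0 lt_neqAle tn1.
  case: Ky => [->|Ky].
    case: Kz => [->|Kz]; first by left; rewrite -scalerDl addrC subrK scale1r.
    by right; rewrite val; nra.
  right; rewrite val; by case: Kz => [->|Kz]; nra.
split; first exact: convex_hull_sub.
move=> y z t /hK Ky /hK Kz /andP[t0 t1] e.
have := val y z t; rewrite -e.
case: Ky => [yx|Ky]; case: Kz => [zx|Kz] //; rewrite ?yx ?zx => ev; exfalso; nra.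
Qed.

Lemma strictly_convex_extreme X x y z (t : R) : strictly_convex X -> X x ->
  convex_hull X y -> convex_hull X z -> 0 < t < 1 ->
  x = t *: y + (1 - t) *: z -> y = x /\ z = x.
Proof. by move=> [_ eX] /eX[_]; exact. Qed.

End ConvexPosition.

(** * Orientation of triples and crossings of segments *)

Section Orientation.
Variable R : realType.
Implicit Types (A X : set 'rV[R]_2) (u v w x y z : 'rV[R]_2).

(** Twice the signed area of the triangle, positive when [x], [y], [z] run counterclockwise. *)
Definition orient x y z : R :=
  (y 0 0 - x 0 0) * (z 0 1 - x 0 1) - (y 0 1 - x 0 1) * (z 0 0 - x 0 0).

Lemma orientC x y z : orient x y z = orient y z x.
Proof. by rewrite /orient; ring. Qed.

Lemma orientN x y z : orient x z y = - orient x y z.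
Proof. by rewrite /orient; ring. Qed.

Lemma orient_eq0_line x y z : x != y -> orient x y z = 0 ->
  exists k : R, z = x + k *: (y - x).
Proof.
move=> xy; rewrite /orient => e.
have [e0|n0] := eqVneq (y 0 0) (x 0 0); last first.
  have d0 : y 0 0 - x 0 0 != 0 by rewrite subr_eq0.
  exists ((z 0 0 - x 0 0) / (y 0 0 - x 0 0)); apply: rowv2P; rewrite !mxE.
    by field.
  apply: (mulfI d0); move/eqP: e; rewrite subr_eq0 => /eqP e.
  by rewrite mulrDr mulrA mulrCA divff // mulr1; lra.
have n1 : y 0 1 - x 0 1 != 0.
  by rewrite subr_eq0; apply: contra_neq xy => e1; exact: rowv2P.
exists ((z 0 1 - x 0 1) / (y 0 1 - x 0 1)); apply: rowv2P; rewrite !mxE.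
  rewrite e0 subrr mulr0 addr0; move/eqP: e.
  rewrite e0 subrr mul0r sub0r oppr_eq0 mulf_eq0 (negbTE n1) /= subr_eq0.
  by move/eqP.
by field.
Qed.

Lemma not_strictly_between A x y z (t : R) : strictly_convex A -> A x ->
  convex_hull A y -> convex_hull A z -> 0 < t < 1 -> y != z ->
  x <> t *: y + (1 - t) *: z.
Proof.
move=> cA Ax Ay Az ht /eqP yz e; apply: yz.
by have [-> ->] := strictly_convex_extreme cA Ax Ay Az ht e.
Qed.

(** Of three distinct collinear points one lies strictly between the others; the position of [k]
    relative to 0 and 1 tells which. *)
Lemma orient_neq0 A x y z : strictly_convex A -> A x -> A y -> A z ->
  x != y -> y != z -> z != x -> orient x y z != 0.
Proof.
move=> cA Ax Ay Az xy yz zx; apply/eqP => /(orient_eq0_line xy)[k e].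
have [hx hy hz] : [/\ convex_hull A x, convex_hull A y & convex_hull A z].
  by split; exact: convex_hull_sub.
have k0 : k != 0.
  by apply: contra_neq zx => k0; rewrite e k0 scale0r addr0.
have k1 : k != 1.
  by apply: contra_neq yz => k1; rewrite e k1 scale1r addrCA subrr addr0.
have ek0 := congr1 (fun v : 'rV[R]_2 => v 0 0) e.
have ek1 := congr1 (fun v : 'rV[R]_2 => v 0 1) e.
move: ek0 ek1; rewrite !mxE => ek0 ek1.
have [kn|kp|ke] := ltgtP k 0; last by rewrite ke eqxx in k0.
- have k1p : 0 < 1 - k by lra.
  apply: (@not_strictly_between A x z y (1 - k)^-1) => //.
    by rewrite invr_gt0 k1p invf_lt1 //; lra.
  by rewrite eq_sym.
  apply: rowv2P; rewrite !mxE ?ek0 ?ek1; field; exact: lt0r_neq0.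
have [kn|kp'|ke] := ltgtP k 1; last by rewrite ke eqxx in k1.
- apply: (@not_strictly_between A z y x k) => //; first by rewrite kp.
    by rewrite eq_sym.
  by apply: rowv2P; rewrite !mxE ?ek0 ?ek1; ring.
apply: (@not_strictly_between A y z x k^-1) => //.
  by rewrite invr_gt0 kp invf_lt1.
by apply: rowv2P; rewrite !mxE ?ek0 ?ek1; field.
Qed.

(* Otherwise [s] is the barycenter of [x], [y], [z] with the three
   orientations as weights. *)
Lemma not_in_triangle A s x y z : strictly_convex A ->
  A s -> A x -> A y -> A z ->
  0 < orient s x y -> 0 < orient s y z -> 0 < orient s z x -> False.
Proof.
move=> cA As Ax Ay Az hc ha hb.
have xy : x != y.
  by apply: contraTneq hc => ->; rewrite /orient mulrC subrr ltxx.
set c := orient s x y in hc *; set a := orient s y z in ha *.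
set b := orient s z x in hb *.
(* The line [zs] meets the side [xy] at [q], so [s] lies strictly between [z] and [q]. *)
pose q := (a / (a + b)) *: x + (1 - a / (a + b)) *: y.
have ab : a + b != 0 by rewrite lt0r_neq0 // addr_gt0.
have abc : a + b + c != 0 by rewrite lt0r_neq0 // addr_gt0 // addr_gt0.
have hq : convex_hull A q.
  apply: convex_hull_convex; [exact: convex_hull_sub..|].
  have hab : 0 < a + b by rewrite addr_gt0.
  by rewrite divr_ge0 ?ltW //= ltr_pdivrMr // mul1r ltrDl.
have [||zs _] := @strictly_convex_extreme R A s z q (c / (a + b + c)) cA As
  (convex_hull_sub Az) hq.
- have hab : 0 < a + b by rewrite addr_gt0.
  have habc : 0 < a + b + c by rewrite addr_gt0.
  by rewrite divr_gt0 //= ltr_pdivrMr // mul1r ltrDr.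
- apply: rowv2P; rewrite !mxE.
    apply: (mulfI abc).
    rewrite (_ : (a + b + c) * (_ + _) = a * x 0 0 + b * y 0 0 + c * z 0 0).
      by rewrite /a /b /c /orient; ring.
    by field; rewrite ab abc.
  apply: (mulfI abc).
  rewrite (_ : (a + b + c) * (_ + _) = a * x 0 1 + b * y 0 1 + c * z 0 1).
    by rewrite /a /b /c /orient; ring.
  by field; rewrite ab abc.
by move: ha; rewrite /a zs /orient !subrr !mulr0 subrr ltxx.
Qed.

(** The segment [xy] crosses the line [uv]. At or beyond [v] it cannot: [v] would lie strictly
    between two hull points. *)
Lemma diagonal_crossing A u v x y : strictly_convex A ->
  A u -> A v -> A x -> A y -> 0 < orient u v x -> orient u v y < 0 ->
  exists l k : R,
    [/\ 0 < l < 1, k < 1 & l *: x + (1 - l) *: y = u + k *: (v - u)].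
Proof.
move=> cA Au Av Ax Ay; set a := orient u v x; set b := orient u v y => ha hb.
have ab : 0 < a - b by lra.
have ab0 := lt0r_neq0 ab.
(* The weight at which [orient u v], affine in its last argument, vanishes. *)
pose l := - b / (a - b).
have hl : 0 < l < 1.
  by rewrite divr_gt0 ?oppr_gt0 //= ltr_pdivrMr // mul1r; lra.
have uv : u != v.
  by apply: contraTneq ha => uv; rewrite /a uv /orient !subrr !mul0r subrr ltxx.
pose c := l *: x + (1 - l) *: y.
have xy : x != y by apply: contraTneq ha => exy; rewrite /a exy -leNgt ltW.
have hc : convex_hull A c.
  apply: convex_hull_convex; [exact: convex_hull_sub..|].
  by case/andP: hl => ? ?; rewrite !ltW.
have /(orient_eq0_line uv)[k ek] : orient u v c = 0.
  have -> : orient u v c = l * a + (1 - l) * b.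
    by rewrite /c /a /b /orient !mxE; ring.
  by rewrite /l; field.
exists l, k; split => //.
rewrite ltNge; apply/negP; rewrite le_eqVlt => /orP[/eqP k1|k1].
  apply: (@not_strictly_between A v x y l) => //; try exact: convex_hull_sub.
  by rewrite -/c ek -k1 scale1r addrCA subrr addr0.
have k0 : 0 < k by apply: lt_trans k1.
have kn := lt0r_neq0 k0.
apply: (@not_strictly_between A v c u k^-1) => //; first exact: convex_hull_sub.
- by rewrite invr_gt0 k0 invf_lt1.
- rewrite ek -subr_eq0 addrAC subrr add0r scaler_eq0 negb_or kn subr_eq0.
  by rewrite eq_sym.
by rewrite ek; apply: rowv2P; rewrite !mxE; field.
Qed.

(** With [u] at 0 and [v] at 1 on their line, the hull points have parameters [a] and [1 - b], on
    either side of the midpoint at 1/2. *)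
Lemma midpoint_separated X u v (a b : R) : strictly_convex X -> u != v ->
  X (2^-1 *: (u + v)) -> a < 2^-1 -> b < 2^-1 ->
  convex_hull X (u + a *: (v - u)) -> convex_hull X (v + b *: (u - v)) ->
  False.
Proof.
move=> cX uv Xm ha hb hu hv.
have d : 1 - b - a != 0 by rewrite lt0r_neq0 //; lra.
have dp : 0 < 1 - b - a by lra.
(* The weight [t] solves [t * a + (1 - t) * (1 - b) = 2^-1]. *)
apply: (@not_strictly_between X _ _ _ ((1 - b - 2^-1) / (1 - b - a)) cX Xm hu hv).
- rewrite divr_gt0 //=; last lra.
  by rewrite ltr_pdivrMr // mul1r; lra.
- have -> : v = u + 1 *: (v - u) by rewrite scale1r addrCA subrr addr0.
  apply/eqP => e; move/eqP: uv; apply; apply/eqP.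
  rewrite eq_sym -subr_eq0 -[_ == 0]orbF -(negbTE d) orbC -scaler_eq0.
  rewrite -subr_eq0 subr0.
  apply/eqP.
  have e0 := congr1 (fun v : 'rV[R]_2 => v 0 0) e.
  have e1 := congr1 (fun v : 'rV[R]_2 => v 0 1) e.
  move: e0 e1; rewrite !mxE => e0 e1.
  by apply: rowv2P; rewrite !mxE; lra.
by apply: rowv2P; rewrite !mxE; field.
Qed.

End Orientation.

Lemma midpoint2 (R : realType) (n : nat) (p : 'I_n -> 'rV[R]_2) (a b : 'I_n) :
  a != b -> midpoint p [set a; b]%SET = 2^-1 *: (p a + p b).
Proof. by move=> ab; rewrite /midpoint big_setU1 ?big_set1 ?inE. Qed.

(** Sending each [u] to the element it is related to maps the complement of [D] onto a set
    containing [E]; [e0] is the value at a [u] related to nothing. *)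
Lemma leq_card_cover (T U : finType) (E : {set T}) (D : {set U})
    (r : U -> T -> bool) :
  (forall e, e \in E -> exists2 u, u \notin D & r u e) ->
  (forall u e e', r u e -> r u e' -> e = e') ->
  (#|E| + #|D| <= #|U|)%N.
Proof.
move=> cov uniq_r.
have [->|[e0 e0E]] := set_0Vmem E; first by rewrite cards0 max_card.
pose f u := odflt e0 [pick e | r u e].
have sub : E \subset f @: ~: D.
  apply/fintype.subsetP => e eE; have [u uD rue] := cov _ eE.
  apply/imsetP; exists u; first by rewrite inE.
  rewrite /f; case: pickP => [e' rue'|/(_ e)]; last by rewrite rue.
  exact: uniq_r rue rue'.
rewrite -(cardsC D) addnC leq_add2l.
exact: leq_trans (subset_leq_card sub) (leq_imset_card _ _).
Qed.

(** * Upper bound, by counting angularly extreme edge ends *)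

Section UpperBound.
Variables (R : realType) (n : nat) (E : {set {set 'I_n}}) (S : {set 'I_n}).
Variable p : 'I_n -> 'rV[R]_2.
Hypothesis graphE : is_graph E.
Hypothesis injp : injective p.
Hypothesis cvxA : strictly_convex (range p).
Hypothesis cvxX : strictly_convex (edge_midpoints p E `|` p @` [set` S]).

Implicit Types a b c s v w x y z : 'I_n.

Let O a b c := 0 < orient (p a) (p b) (p c).
Let adj a b := [set a; b]%SET \in E.

Let rangep a : range p (p a). Proof. by exists a. Qed.

Let adjC a b : adj a b = adj b a.
Proof. by rewrite /adj finset.setUC. Qed.

Let adj_neq a b : adj a b -> a != b.
Proof. by move=> /graphE; rewrite cards2; case: eqP. Qed.

Let p_neq a b : a != b -> p a != p b.
Proof. by rewrite (inj_eq injp). Qed.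

Let OC a b c : O a b c = O b c a.
Proof. by rewrite /O orientC. Qed.

Let O_asym a b c : O a b c -> O a c b -> False.
Proof. by rewrite /O orientN => ? ?; lra. Qed.

Let O_irr a b : O a b b = false.
Proof. by apply/negP => h; exact: (O_asym h h). Qed.

Let O_total a b c : a != b -> b != c -> c != a -> ~~ O a b c -> O a c b.
Proof.
move=> ab bc ca; rewrite /O [orient _ (p c) _]orientN.
have := orient_neq0 cvxA (rangep a) (rangep b) (rangep c).
move=> /(_ (p_neq ab) (p_neq bc) (p_neq ca)) h; rewrite -leNgt => h'.
by rewrite oppr_gt0 lt_neqAle h.
Qed.

Let O_neq a b c : O a b c -> [/\ a != b, b != c & c != a].
Proof.
move=> h; split; apply: contraTneq h => h.
- by rewrite OC OC h O_irr.
- by rewrite h O_irr.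
- by rewrite OC h O_irr.
Qed.

(** Around an arbitrary point the angular order is only cyclic. Here [O s z x] would put [s] inside
    the triangle [xyz]. *)
Let O_trans s x y z : O s x y -> O s y z -> O s x z.
Proof.
move=> xy yz; have [sx nxy ys] := O_neq xy; have [sy nyz zs] := O_neq yz.
have xz : x != z by apply/eqP => e; rewrite -e in yz; exact: (O_asym xy yz).
apply/negPn/negP => /(O_total sx xz zs) zx.
exact: (not_in_triangle cvxA (rangep s) (rangep x) (rangep y) (rangep z)).
Qed.

(** Otherwise [y] would lie inside the triangle [sxz]. *)
Let O_convex s x y z : O s x y -> O s y z -> O x y z.
Proof.
move=> xy yz; have xz := O_trans xy yz.
have [sx nxy ys] := O_neq xy; have [sy nyz zs] := O_neq yz.
have [_ nxz _] := O_neq xz.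
apply/negPn/negP => /(O_total nxy nyz); rewrite eq_sym => /(_ nxz) h.
apply: (not_in_triangle cvxA (rangep y) (rangep s) (rangep x) (rangep z)).
- by rewrite -/(O y s x) OC.
- by rewrite -/(O y x z) OC.
- by rewrite -/(O y z s) -OC.
Qed.

(* [slot v true w] (resp. [slot v false w]) says that in the angular order
   around [v], the edge [vw] is the first (resp. the last) edge at [v]. *)
Let slot v (side : bool) w := adj v w &&
  [forall x, adj v x ==> (x != w) ==> (if side then O v w x else O v x w)].

Let slotP v side w : reflect (adj v w /\
    forall x, adj v x -> x != w -> if side then O v w x else O v x w)
  (slot v side w).
Proof.
apply: (iffP andP) => -[vw h]; split => //.
  by move=> x vx xw; have /forallP/(_ x)/implyP/(_ vx)/implyP/(_ xw) := h.
by apply/forallP => x; apply/implyP => vx; apply/implyP => xw; apply: h.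
Qed.

Let slot_uniq v side w w' : slot v side w -> slot v side w' -> w = w'.
Proof.
move=> /slotP[vw h] /slotP[vw' h']; apply/eqP/negPn/negP => ww'.
have := h' _ vw ww'; rewrite eq_sym in ww'; have := h _ vw' ww'.
by case: side {h h'} => /O_asym; exact.
Qed.

Let in_midpoints a b : adj a b ->
  (edge_midpoints p E `|` p @` [set` S]) (2^-1 *: (p a + p b)).
Proof.
by move=> ab; left; exists [set a; b]%SET; rewrite ?midpoint2 ?adj_neq.
Qed.

(** There are neighbours [x] and [y] of [a] on either side of [ab], and [xy] meets the line [ab]
    before [b]. The homothety of ratio 1/2 centred at [p a] carries this crossing to the segment
    between the midpoints of [ax] and [ay]. *)
Let not_slot a b : adj a b -> (forall side, ~~ slot a side b) ->
  exists2 k : R, k < 2^-1 &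
    convex_hull (edge_midpoints p E `|` p @` [set` S]) (p a + k *: (p b - p a)).
Proof.
move=> ab ns.
have bad side : exists2 x, adj a x & if side then O a x b else O a b x.
  move: (ns side); rewrite /slot ab /= negb_forall => /existsP[x].
  rewrite !negb_imply => /and3P[ax xb h]; exists x => //.
  have [na nx] := (adj_neq ab, adj_neq ax).
  by case: side h; apply: O_total; rewrite // eq_sym.
have [y ay Oy] := bad true; have [x ax Ox] := bad false.
have Oy' : orient (p a) (p b) (p y) < 0.
  by move: Oy; rewrite /O orientN oppr_gt0.
have [l [k [hl k1 e]]] := diagonal_crossing cvxA (rangep a) (rangep b)
  (rangep x) (rangep y) Ox Oy'.
exists (k / 2); first by lra.
have -> : p a + (k / 2) *: (p b - p a) =
    l *: (2^-1 *: (p a + p x)) + (1 - l) *: (2^-1 *: (p a + p y)).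
  have -> : p a + (k / 2) *: (p b - p a) =
    2^-1 *: (p a + (p a + k *: (p b - p a))).
    by apply: rowv2P; rewrite !mxE; field.
  by rewrite -e; apply: rowv2P; rewrite !mxE; ring.
apply: convex_hull_convex; do ?by apply: convex_hull_sub; exact: in_midpoints.
by case/andP: hl => ? ?; rewrite !ltW.
Qed.

(** Otherwise the midpoint would lie strictly between [p a], at parameter 0, and the hull point
    given by [not_slot] at [b]. *)
Let slot_at_S a b : adj a b -> a \in S -> exists side, slot b side a.
Proof.
move=> ab aS; apply/not_existsP => h; have ba : adj b a by rewrite adjC.
have [|k hk hull] := not_slot ba; first by move=> side; apply/negP/h.
apply: (midpoint_separated (a := 0) cvxX (p_neq (adj_neq ab)) (in_midpoints ab)
  _ hk _ hull).
  by rewrite invr_gt0.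
by rewrite scale0r addr0; apply: convex_hull_sub; right; exists a.
Qed.

(** Otherwise [not_slot] at both ends gives hull points on either side of the midpoint. *)
Let slot_some_end a b : adj a b ->
  (exists side, slot a side b) \/ (exists side, slot b side a).
Proof.
move=> ab; have [|ha] := pselect (exists side, slot a side b); first by left.
have [|hb] := pselect (exists side, slot b side a); first by right.
have ba : adj b a by rewrite adjC.
have [|k hk hull] := not_slot ab.
  by move=> side; apply/negP => h; apply: ha; exists side.
have [|k' hk' hull'] := not_slot ba.
  by move=> side; apply/negP => h; apply: hb; exists side.
exfalso; exact: (midpoint_separated cvxX (p_neq (adj_neq ab)) (in_midpoints ab)
  hk hk' hull hull').
Qed.

Let S_independent a b : adj a b -> a \in S -> b \notin S.
Proof.
move=> ab aS; apply/negP => bS.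
apply: (midpoint_separated cvxX (p_neq (adj_neq ab)) (in_midpoints ab)
  (a := 0) (b := 0)); rewrite ?invr_gt0 // scale0r addr0;
  apply: convex_hull_sub; right; by [exists a|exists b].
Qed.

Let edgeP e : e \in E -> exists a b, e = [set a; b]%SET /\ adj a b.
Proof.
move=> eE; have /eqP/cards2P[a [b [ab e_ab]]] := graphE eE.
by exists a, b; rewrite /adj -e_ab.
Qed.

Let edge_slot e : e \in E -> exists v side w,
  [/\ v \notin S, e = [set v; w]%SET & slot v side w].
Proof.
move=> /edgeP[a [b [-> ab]]]; have ba : adj b a by rewrite adjC.
have [aS|aS] := boolP (a \in S).
  have [side h] := slot_at_S ab aS; exists b, side, a.
  by rewrite (S_independent ab aS) finset.setUC.
have [bS|bS] := boolP (b \in S).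
  by have [side h] := slot_at_S ba bS; exists a, side, b.
case: (slot_some_end ab) => -[side h]; first by exists a, side, b.
by exists b, side, a; rewrite finset.setUC.
Qed.

(** Each edge is charged to one of the [2 * n] pairs of a vertex and a side. No edge is charged to a
    pair at [S], nor to the first slot of an [a] in [W]: that edge is also last at [b] and is
    charged there. *)
Let card_edges_wasted (W : {set 'I_n}) :
  (forall a, a \in W -> a \notin S /\
     exists2 b, b \notin S & slot a true b /\ slot b false a) ->
  (#|E| + (2 * #|S| + #|W|) <= 2 * n)%N.
Proof.
move=> hW; pose D := (finset.setX S [set: bool] :|: finset.setX W [set true])%SET.
have -> : (2 * #|S| + #|W| = #|D|)%N.
  rewrite cardsU !cardsX cardsT card_bool cards1 muln1 mulnC.
  rewrite (_ : _ :&: _ = finset.set0)%SET ?cards0 ?subn0 //.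
  apply/setP => -[a side]; rewrite !inE /= andbT; apply/negP.
  by move=> /and3P[aS /hW[/negP]].
have -> : (2 * n = #|{: 'I_n * bool}|)%N.
  by rewrite card_prod card_ord card_bool mulnC.
pose r (u : 'I_n * bool) (e : {set 'I_n}) :=
  [exists w, (e == [set u.1; w]%SET) && slot u.1 u.2 w].
apply: (leq_card_cover (r := r)).
  move=> e /edge_slot[v [side [w [vS e_vw vw]]]].
  have [inD|notD] := boolP ((v, side) \in D); last first.
    by exists (v, side) => //; apply/existsP; exists w; rewrite /= e_vw eqxx.
  (* By uniqueness the edge in the surrendered slot [(v, true)] is [vb], which also occupies
     [(b, false)], outside [D]. *)
  move: inD; rewrite !inE /= (negbTE vS) /= => /andP[/hW[_ [b bS [vb bv]]]].
  move=> /eqP side_t; rewrite side_t in vw.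
  exists (b, false); first by rewrite !inE /= (negbTE bS) andbF.
  apply/existsP; exists v; rewrite /= bv andbT e_vw (slot_uniq vw vb).
  by rewrite finset.setUC.
move=> u e e' /existsP[w /andP[/eqP-> h]] /existsP[w' /andP[/eqP-> h']].
by rewrite (slot_uniq h h').
Qed.

(* Among the edges [ab] avoiding [s], take one cutting off fewest points on the
   side away from [s]: no other edge at [a] or [b] lies on that side. *)
Let doubly_extreme_edge s : (forall e, e \in E -> s \in e) \/
  exists a b, [/\ a != s, b != s, slot a true b & slot b false a].
Proof.
have [|no] := pselect (forall e, e \in E -> s \in e); [by left|right].
have [a0 [b0 h0]] : exists a0 b0, adj a0 b0 && O s a0 b0.
  move/existsNP: no => [e /not_implyP[eE /negP]].
  have [a [b [-> ab]]] := edgeP eE.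
  rewrite !inE negb_or => /andP[sa sb]; rewrite eq_sym in sb.
  have [Oab|/(O_total sa (adj_neq ab) sb) Oba] := boolP (O s a b).
    by exists a, b; rewrite ab.
  by exists b, a; rewrite adjC ab.
pose btw (q : 'I_n * 'I_n) := [set c | O s q.1 c & O s c q.2]%SET.
case: (@arg_minnP _ (a0, b0) (fun q => adj q.1 q.2 && O s q.1 q.2)
  (fun q => #|btw q|)) => // -[a b] /= /andP[ab Oab] min_ab.
have [sa nab bs] := O_neq Oab.
(* [s] is to the left of [ab]; a vertex to the right is seen from [s] between [a] and [b], that is,
   it lies in [btw (a, b)]. *)
have side c : c != a -> c != b -> ~~ O a b c -> O s a c /\ O s c b.
  move=> ca cb Nabc; have cs : c != s.
    by apply: contraNneq Nabc => ->; rewrite -OC.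
  have bc : b != c by rewrite eq_sym.
  have ac : a != c by rewrite eq_sym.
  split; apply/negPn/negP.
    move=> /(O_total sa ac cs) Oca.
    by move/negP: Nabc; apply; rewrite -OC; exact: O_convex Oca Oab.
  rewrite eq_sym in cs; rewrite eq_sym in bs => /(O_total cs cb).
  rewrite eq_sym => /(_ bs) Obc.
  by move/negP: Nabc; apply; exact: O_convex Oab Obc.
exists a, b; split=> //; first by rewrite eq_sym.
  apply/slotP; split=> // c ac cb; apply/negPn/negP => Nabc.
  have [|//|Oac Ocb] := side c _ _ Nabc; first by rewrite eq_sym adj_neq.
  (* The edge [ac] would cut off strictly fewer vertices than [ab], since [c] itself is lost. *)
  have := min_ab (a, c); rewrite /= ac Oac => /(_ isT); apply/negP.
  rewrite -ltnNge; apply/proper_card/properP; split.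
    apply/fintype.subsetP => d; rewrite !inE /= => /andP[-> Odc].
    exact: O_trans Odc Ocb.
  by exists c; rewrite !inE /= ?Oac ?Ocb // O_irr.
apply/slotP; split=> [|c bc ca]; first by rewrite adjC.
rewrite -OC; apply/negPn/negP => Nabc.
have [//||Oac Ocb] := side c _ _ Nabc; first by rewrite eq_sym adj_neq.
have := min_ab (c, b); rewrite /= adjC bc Ocb => /(_ isT); apply/negP.
rewrite -ltnNge; apply/proper_card/properP; split.
  apply/fintype.subsetP => d; rewrite !inE /= => /andP[Ocd ->].
  by rewrite andbT; exact: O_trans Oac Ocd.
by exists c; rewrite !inE /= ?Oac ?Ocb // O_irr.
Qed.

Let card_star s : (forall e, e \in E -> s \in e) -> (#|E| <= n.-1)%N.
Proof.
move=> star; have -> : (n.-1 = #|[set~ s]%SET|)%N.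
  by rewrite cardsC1 card_ord.
apply: leq_trans (leq_imset_card (fun w => [set s; w]%SET) _).
apply/subset_leq_card/fintype.subsetP => e eE; move: (star _ eE).
have [a [b [-> ab]]] := edgeP eE; have nab := adj_neq ab.
rewrite !inE => /orP[]/eqP->; apply/imsetP; [exists b|exists a] => //.
- by rewrite !inE eq_sym.
- by rewrite !inE.
- by rewrite finset.setUC.
Qed.

(** The slot count alone gives [2 * n - #|S|], enough once [2 <= #|S|]. Below that, one or two
    doubly extreme edges supply the missing units, and stars are counted directly. *)
Lemma card_edges_vertices_le : (2 <= n)%N -> (#|E| + #|S| <= 2 * n - 2)%N.
Proof.
move=> n2; have [S2|S1] := leqP 2 #|S|.
  have := @card_edges_wasted finset.set0; rewrite cards0 => h.
  have {h} : (#|E| + (2 * #|S| + 0) <= 2 * n)%N by apply: h => a; rewrite inE.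
  by lia.
have [/eqP S0|Sn0] := boolP (#|S| == 0)%N; last first.
  have /eqP/cards1P[s eS] : #|S| = 1%N by lia.
  have [/card_star|[a [b [as_ bs ab ba]]]] := doubly_extreme_edge s; first by lia.
  have := @card_edges_wasted [set a]%SET; rewrite cards1 => h.
  have {h} : (#|E| + (2 * #|S| + 1) <= 2 * n)%N.
    apply: h => _ /set1P->; rewrite eS !inE; split=> //.
    by exists b; rewrite ?inE.
  by lia.
have notS x : x \notin S by rewrite (cards0_eq S0) inE.
(* The first base point is arbitrary; the second is [a], so that the two surrendered first slots
   belong to distinct vertices. *)
have [/card_star|] := doubly_extreme_edge (Ordinal (ltnW n2)); first by lia.
move=> [a [b [_ _ ab ba]]].
have [/card_star|] := doubly_extreme_edge a; first by lia.
move=> [a' [b' [a'a _ ab' ba']]].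
have := @card_edges_wasted [set a; a']%SET; rewrite cards2 eq_sym a'a => h.
have {h} : (#|E| + (2 * #|S| + 2) <= 2 * n)%N.
  by apply: h => _ /set2P[]->; split=> //; [exists b|exists b'].
by lia.
Qed.

End UpperBound.

Lemma midpoint_neq_vertex (R : realType) (n : nat) (p : 'I_n -> 'rV[R]_2)
    (e : {set 'I_n}) (v : 'I_n) :
  injective p -> strictly_convex (range p) -> #|e| = 2%N ->
  midpoint p e <> p v.
Proof.
move=> injp cvxA /eqP/cards2P[a [b [ab ->]]].
rewrite midpoint2 // => ev.
apply: (@not_strictly_between _ _ (p v) (p a) (p b) 2^-1 cvxA).
- by exists v.
- by apply: convex_hull_sub; exists a.
- by apply: convex_hull_sub; exists b.
- by lra.
- by rewrite (inj_eq injp).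
by rewrite -ev; apply: rowv2P; rewrite !mxE; field.
Qed.

(** * Strict convexity of half-integer points *)

Section HalfIntegerPoints.
Variables (R : realType) (T : finType) (P : pred T) (X Y : T -> int).

(** Doubled coordinates are integers, so supporting lines can be checked by integer arithmetic. *)
Definition half_point (t : T) : 'rV[R]_2 :=
  2^-1 *: \row_j (if j == 0 then X t else Y t)%:~R.

Hypothesis support : forall t, P t -> exists a b : int, forall t', P t' ->
  t' != t -> a * X t + b * Y t < a * X t' + b * Y t'.

Let support_half t : P t -> exists a b : R, forall t', P t' -> t' != t ->
  a * half_point t 0 0 + b * half_point t 0 1
  < a * half_point t' 0 0 + b * half_point t' 0 1.
Proof.
move=> /support[a [b hab]]; exists a%:~R, b%:~R => t' Pt' t't.
rewrite !mxE /= ![_ * (2^-1 * _)]mulrCA -!mulrDr ltr_pM2l ?invr_gt0 //.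
by rewrite -!intrM -!intrD ltr_int hab.
Qed.

Lemma half_point_inj : {in P &, injective half_point}.
Proof.
move=> t t' Pt Pt' e; apply/eqP/negPn/negP => tt'; rewrite eq_sym in tt'.
have [a [b /(_ _ Pt' tt')]] := support_half Pt.
by rewrite e ltxx.
Qed.

Lemma half_point_convex : strictly_convex (half_point @` [set t | P t]).
Proof.
apply: strictly_convex_support; first exact: finite_image.
move=> _ [t Pt <-]; have [a [b h]] := support_half Pt; exists a, b.
move=> _ [t' Pt' <-] tt'; apply: h => //.
by apply: contraNneq tt' => ->.
Qed.

End HalfIntegerPoints.

Lemma card_odd_ord n : #|[set i : 'I_n | odd i]%SET| = n./2.
Proof.
rewrite -sum1dep_card big_mkcond /=; elim: n => [|n IH]; first by rewrite big_ord0.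
by rewrite big_ord_recr /= IH; case: (odd n) (odd_double_half n) => /=; lia.
Qed.

(** * Supporting lines of the parabolic polygon, in doubled coordinates *)

Section ParabolaSupport.
Implicit Types i j k m : int.

(** The closing chord, from vertex 0 to vertex [m], has slope [m]. A line of slope [m + 1/2] through
    its midpoint keeps vertex [m] on the inner side and cuts off only vertex 0, which is even. *)
Lemma support_top_vertex j m : 1 <= j -> j <= m ->
  (2 * m + 1) * m - 2 * m ^+ 2 < (2 * m + 1) * (2 * j) - 2 * (2 * j ^+ 2).
Proof.
move=> j1 jm; have : 0 <= (j - 1) * (m - j) by apply: mulr_ge0; lia.
rewrite !expr2; lia.
Qed.

(** For [m = 1] the closing chord and the only side share their midpoint. *)
Lemma support_top_midpoint j m : 2 <= m -> 0 <= j -> j + 1 <= m ->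
  (2 * m + 1) * m - 2 * m ^+ 2 <
  (2 * m + 1) * (2 * j + 1) - 2 * (2 * j ^+ 2 + 2 * j + 1).
Proof.
move=> m2 j0 jm; have : 0 <= j * (m - j - 1) by apply: mulr_ge0; lia.
rewrite !expr2; lia.
Qed.

(** The side from [i] to [i + 1] has slope [2 * i + 1]. For odd [i] the line through its midpoint
    gets slope [2 * i + 3/2]: vertex [i] stays above it and only the even vertex [i + 1] falls
    below. *)
Lemma support_odd_midpoint_midpoint i j : j != i ->
  - (4 * i + 3) * (2 * i + 1) + 2 * (2 * i ^+ 2 + 2 * i + 1) <
  - (4 * i + 3) * (2 * j + 1) + 2 * (2 * j ^+ 2 + 2 * j + 1).
Proof.
move=> ji; have : 0 <= `|j - i| * (`|j - i| - 1) by apply: mulr_ge0; lia.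
by have [ij|ij] := lerP i j; rewrite !expr2; nia.
Qed.

(** For even [i] the slope [2 * i + 1/2] keeps vertex [i + 1] above the line and drops vertex
    [i]. *)
Lemma support_even_midpoint_midpoint i j : j != i ->
  - (4 * i + 1) * (2 * i + 1) + 2 * (2 * i ^+ 2 + 2 * i + 1) <
  - (4 * i + 1) * (2 * j + 1) + 2 * (2 * j ^+ 2 + 2 * j + 1).
Proof.
move=> ji; have : 0 <= `|j - i| * (`|j - i| - 1) by apply: mulr_ge0; lia.
by have [ij|ij] := lerP i j; rewrite !expr2; nia.
Qed.

Lemma support_odd_midpoint_vertex i k :
  - (4 * i + 3) * (2 * i + 1) + 2 * (2 * i ^+ 2 + 2 * i + 1) <
  - (4 * i + 3) * (2 * (i + 2 * k)) + 2 * (2 * (i + 2 * k) ^+ 2).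
Proof.
rewrite -subr_gt0; set d := (X in 0 < X).
(* Both real roots lie strictly between 0 and 1, so the value is positive at every integer. *)
have -> : d = 16 * (k * k) - 12 * k + 1 by rewrite /d; ring.
have [k0|k0] := lerP 1 k.
  by have : 0 <= k * (k - 1); [apply: mulr_ge0; lia|lia].
by have := sqr_ge0 k; rewrite expr2; lia.
Qed.

Lemma support_even_midpoint_vertex i k :
  - (4 * i + 1) * (2 * i + 1) + 2 * (2 * i ^+ 2 + 2 * i + 1) <
  - (4 * i + 1) * (2 * (i + 2 * k + 1)) + 2 * (2 * (i + 2 * k + 1) ^+ 2).
Proof.
rewrite -subr_gt0; set d := (X in 0 < X).
(* Here both roots lie strictly between -1 and 0. *)
have -> : d = 16 * (k * k) + 12 * k + 1 by rewrite /d; ring.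
have [k0|k0] := lerP 0 k.
  by have := sqr_ge0 k; rewrite expr2; lia.
by have : 0 <= - k * (- k - 1); [apply: mulr_ge0; lia|lia].
Qed.

Lemma support_odd_midpoint_top i m : 1 <= i -> i + 1 <= m ->
  - (4 * i + 3) * (2 * i + 1) + 2 * (2 * i ^+ 2 + 2 * i + 1) <
  - (4 * i + 3) * m + 2 * m ^+ 2.
Proof.
move=> i1 im; have : 0 <= (m - i - 1) * (m - i - 1) by apply: mulr_ge0; lia.
have : 0 <= i * i by apply: mulr_ge0; lia.
rewrite !expr2; lia.
Qed.

Lemma support_even_midpoint_top i m : 0 <= i -> i + 1 <= m -> 2 <= m ->
  - (4 * i + 1) * (2 * i + 1) + 2 * (2 * i ^+ 2 + 2 * i + 1) <
  - (4 * i + 1) * m + 2 * m ^+ 2.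
Proof.
move=> i0 im m2; have : 0 <= (m - i - 1) * (m - i - 1) by apply: mulr_ge0; lia.
have : 0 <= i * i by apply: mulr_ge0; lia.
rewrite !expr2; lia.
Qed.

(** The line is the tangent at vertex [i], and the difference is [2 * (j - i) ^+ 2]. The factor [1]
    makes the statement match [a * X t + b * Y t]. *)
Lemma support_vertex_vertex i j : j != i ->
  - 2 * i * (2 * i) + 1 * (2 * i ^+ 2) < - 2 * i * (2 * j) + 1 * (2 * j ^+ 2).
Proof.
move=> ji; have : 0 < (j - i) ^+ 2 by rewrite exprn_even_gt0 //= subr_eq0.
rewrite !expr2; lia.
Qed.

(** The difference is [(j - i) ^+ 2 + (j - i + 1) ^+ 2]. *)
Lemma support_vertex_midpoint i j :
  - 2 * i * (2 * i) + 1 * (2 * i ^+ 2) <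
  - 2 * i * (2 * j + 1) + 1 * (2 * j ^+ 2 + 2 * j + 1).
Proof. by have := sqr_ge0 (j - i); have := sqr_ge0 (j - i + 1); nia. Qed.

Lemma support_vertex_top i m : 1 <= i ->
  - 2 * i * (2 * i) + 1 * (2 * i ^+ 2) < - 2 * i * m + 1 * m ^+ 2.
Proof.
move=> i1; have := sqr_ge0 (m - i).
have : 0 <= (i - 1) * i by apply: mulr_ge0; lia.
rewrite !expr2; lia.
Qed.

End ParabolaSupport.

(** * Lower bound, from a parabolic polygon with [m + 1] vertices *)

Section LowerBound.
Variables (R : realType) (m : nat).
Hypothesis m2 : (2 <= m)%N.

(* Twice the vertices [(i, i^2)] ([inr i]), twice the midpoints of consecutive
   vertices ([inl i], [i < m]) and of the two end vertices ([inl m]). *)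
Let X (t : 'I_m.+1 + 'I_m.+1) : int := match t with
  | inl i => if i == m :> nat then m%:Z else 2 * i%:Z + 1
  | inr i => 2 * i%:Z end.
Let Y (t : 'I_m.+1 + 'I_m.+1) : int := match t with
  | inl i => if i == m :> nat then m%:Z ^+ 2 else 2 * i%:Z ^+ 2 + 2 * i%:Z + 1
  | inr i => 2 * i%:Z ^+ 2 end.
Let P (t : 'I_m.+1 + 'I_m.+1) : bool :=
  match t with inl _ => true | inr i => odd i end.

Let ord_le_m (i : 'I_m.+1) : (i <= m)%N. Proof. by rewrite -ltnS. Qed.

Let support t : P t -> exists a b : int, forall t', P t' ->
  t' != t -> a * X t + b * Y t < a * X t' + b * Y t'.
Proof.
case: t => i.
  rewrite /X /Y; have [im|im] /= := eqVneq (i : nat) m => _.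
    exists (2 * m%:Z + 1), (-2) => -[] j /=; have jm := ord_le_m j.
      have [jm'|jm'] /= := eqVneq (j : nat) m => _ nji.
        by case/eqP: nji; congr inl; apply: val_inj; rewrite /= im.
      by rewrite !mulNr; apply: support_top_midpoint; lia.
    by move=> oj _; rewrite !mulNr; apply: support_top_vertex; lia.
  have lim : (i < m)%N by rewrite ltn_neqAle im ord_le_m.
  have [oi|oi] := boolP (odd i).
    exists (- (4 * i%:Z + 3)), 2; case=> j /=; have jm := ord_le_m j.
      have [jm'|jm'] /= := eqVneq (j : nat) m => _ nji.
        by apply: support_odd_midpoint_top; lia.
      by apply: support_odd_midpoint_midpoint; exact: nji.
    move=> oj _.
    have -> : j%:Z = i%:Z + 2 * (j./2%:Z - i./2%:Z) by lia.
    exact: support_odd_midpoint_vertex.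
  exists (- (4 * i%:Z + 1)), 2; case=> j /=; have jm := ord_le_m j.
    have [jm'|jm'] /= := eqVneq (j : nat) m => _ nji.
      by apply: support_even_midpoint_top; lia.
    by apply: support_even_midpoint_midpoint; exact: nji.
  move=> oj _.
  have -> : j%:Z = i%:Z + 2 * (j./2%:Z - i./2%:Z) + 1 by lia.
  exact: support_even_midpoint_vertex.
move=> oi; exists (- 2 * i%:Z), 1 => -[] j /=; rewrite /X /Y.
  have [jm'|jm'] /= := eqVneq (j : nat) m => _ nji.
    by apply: support_vertex_top; move: oi => /=; lia.
  exact: support_vertex_midpoint.
by move=> _ nji; apply: support_vertex_vertex; exact: nji.
Qed.

Let q := half_point R X Y.
Let p (i : 'I_m.+1) := half_point R (X \o inr) (Y \o inr) i.

(** This covers the even vertices too, for the strict convexity of the whole vertex set. *)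
Let support_vertices (i : 'I_m.+1) : true -> exists a b : int,
  forall j : 'I_m.+1, true -> j != i ->
  a * X (inr i) + b * Y (inr i) < a * X (inr j) + b * Y (inr j).
Proof.
move=> _; exists (- 2 * i%:Z), 1 => j _ ji.
by apply: support_vertex_vertex; exact: ji.
Qed.

Let injp : injective p.
Proof. by move=> i j; apply: (half_point_inj support_vertices). Qed.

Let cvxA : strictly_convex (range p).
Proof.
apply: strictly_convex_sub (half_point_convex R support_vertices).
by move=> _ [i _ <-]; exists i.
Qed.

Let cyc_edge (i : 'I_m.+1) := [set i; ordS i]%SET.

Let ordS_val (i : 'I_m.+1) :
  ordS i = (if i == m :> nat then 0 else i.+1) :> nat.
Proof.
rewrite /=; have [->|im] := eqVneq (i : nat) m; first by rewrite modnn.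
by rewrite modn_small // ltnS ltn_neqAle im ord_le_m.
Qed.

Let neq_ordS (i : 'I_m.+1) : i != ordS i.
Proof.
apply/eqP => /(congr1 (@nat_of_ord _)); rewrite ordS_val.
by case: eqP; lia.
Qed.

Let midpoint_cyc_edge i : midpoint p (cyc_edge i) = q (inl i).
Proof.
rewrite midpoint2 ?neq_ordS //; have := ordS_val i.
move: (ordS i) => k ek; apply: rowv2P; rewrite !mxE /= ek.
  have [->|im] := eqVneq (i : nat) m; last by rewrite !intrD !intrM; field.
  by rewrite !intrM; field.
have [->|im] := eqVneq (i : nat) m; last by rewrite !intrD !intrM; field.
by rewrite !intrM; field.
Qed.

Lemma cycle_odd_admissible : exists E S : {set _},
  @admissible R m.+1 E S /\ (#|E| + #|S| = m.+1 + m.+1./2)%N.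
Proof.
have injq := half_point_inj (R := R) support.
exists (cyc_edge @: [set: 'I_m.+1])%SET, [set i : 'I_m.+1 | odd i]%SET; split; last first.
  (* The sides are distinct edges because their midpoints are distinct. *)
  rewrite card_odd_ord card_in_imset ?cardsT ?card_ord // => i j _ _ eij.
  have /injq : q (inl i) = q (inl j) by rewrite -!midpoint_cyc_edge eij.
  by move=> /(_ isT isT)[].
have graphE : is_graph (cyc_edge @: [set: 'I_m.+1])%SET.
  by move=> _ /imsetP[i _ ->]; rewrite cards2 neq_ordS.
have cvxX : strictly_convex (edge_midpoints p (cyc_edge @: [set: 'I_m.+1])%SET
    `|` p @` [set` [set i : 'I_m.+1 | odd i]%SET]).
  apply: strictly_convex_sub (half_point_convex R support).
  move=> _ [[_ /imsetP[i _ ->] <-]|[i oi <-]].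
    by exists (inl i) => //; rewrite midpoint_cyc_edge.
  by exists (inr i); first by move: oi; rewrite /= inE.
split=> //; exists p; split=> //; last first.
  by apply: strictly_convex_sub cvxX => x; left.
split=> // [|e v eE]; last exact: midpoint_neq_vertex (graphE _ eE).
move=> _ _ /imsetP[i _ ->] /imsetP[j _ ->]; rewrite !midpoint_cyc_edge.
by move=> /injq => /(_ isT isT)[->].
Qed.

End LowerBound.

(** * Translation between drawings and convex subsets of the sumset *)

Section Sumset.
Variables (R : realType) (n : nat).

(** An edge [ab] contributes [p a + p b] and a vertex [v] of [S] contributes [p v + p v]; the
    conditions on a drawing make these sums distinct. *)
Lemma admissible_sumset (E : {set {set 'I_n}}) (S : {set 'I_n}) :
  admissible R E S -> convex_sumset_card R n (#|E| + #|S|).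
Proof.
move=> [graphE [p [[injp injE disj] cvxA _ cvxX]]].
pose sX := [seq 2 *: midpoint p e | e <- enum E] ++ [seq 2 *: p v | v <- enum S].
have two0 : (2 : R) != 0 by rewrite pnatr_eq0.
have uX : uniq sX.
  rewrite cat_uniq; apply/and3P; split.
  - rewrite map_inj_in_uniq ?enum_uniq // => e e'; rewrite !mem_enum => eE e'E.
    by move=> /(scalerI two0); exact: injE.
  - apply/hasPn => _ /mapP[v vS ->]; apply/mapP => -[e].
    by rewrite mem_enum => eE /(scalerI two0)/esym; exact: disj.
  by rewrite map_inj_uniq ?enum_uniq // => v v' /(scalerI two0)/injp.
have uA : uniq (map p (enum 'I_n)) by rewrite map_inj_uniq ?enum_uniq.
exists [fset x in map p (enum 'I_n)]%fset, [fset x in sX]%fset; split.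
- apply: strictly_convex_sub cvxA => x /=.
  by rewrite !inE => /mapP[i _ ->]; exists i.
- by rewrite card_fseq undup_id // size_map size_enum_ord.
- apply: strictly_convex_sub (strictly_convex_scale two0 cvxX) => x /=.
  rewrite !inE => /orP[]/mapP[y]; rewrite mem_enum => yin ->.
    by exists (midpoint p y) => //; left; exists y.
  by exists (p y) => //; right; exists y.
- move=> x /=; rewrite !inE => /orP[]/mapP[y]; rewrite mem_enum => yin ->.
    have /eqP/cards2P[a [b [ab ->]]] := graphE _ yin.
    exists (p a); first by rewrite /= !inE map_f // mem_enum.
    exists (p b); first by rewrite /= !inE map_f // mem_enum.
    by rewrite midpoint2 // scalerA divff // scale1r.
  exists (p y); first by rewrite /= !inE map_f // mem_enum.
  exists (p y); first by rewrite /= !inE map_f // mem_enum.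
  by rewrite -mulr2n scaler_nat.
by rewrite card_fseq undup_id // size_cat size_map size_map -!cardE.
Qed.

(** For each point of [X] one way of writing it as a sum is chosen: two distinct summands give an
    edge, equal summands a vertex of [S]. *)
Lemma sumset_admissible (k : nat) : convex_sumset_card R n k ->
  exists E S, @admissible R n E S /\ (#|E| + #|S| = k)%N.
Proof.
move=> [A [X [cvxA cA cvxX XA cX]]].
pose p (i : 'I_n) : 'rV[R]_2 := nth 0 (enum_fset A) i.
have injp : injective p.
  move=> i j /eqP; rewrite nth_uniq ?fset_uniq // -?cardfE ?cA //.
  by move/eqP/val_inj.
have pA i : p i \in A by rewrite /p mem_nth // cA.
have Ap a : a \in A -> exists i, p i = a.
  move=> aA; have ia : (index a (enum_fset A) < n)%N by rewrite -cA index_mem.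
  by exists (Ordinal ia); rewrite /p nth_index.
(* The factor makes [pt [set u; v]] equal to [p u + p v] also when [u = v]. *)
pose pt (e : {set 'I_n}) : 'rV[R]_2 := (2 / #|e|%:R) *: \sum_(v in e) p v.
have two0 : (2 : R) != 0 by rewrite pnatr_eq0.
have pt1 v : pt [set v]%SET = 2 *: p v.
  by rewrite /pt cards1 divr1 big_set1.
have pt2 (e : {set 'I_n}) : #|e| = 2%N -> pt e = 2 *: midpoint p e.
  by move=> e2; rewrite /pt /midpoint e2 scalerA.
have rep x : exists e : {set 'I_n},
    x \in X -> pt e = x /\ (#|e| == 1)%N || (#|e| == 2)%N.
  have [xX|] := boolP (x \in X); last by exists finset.set0.
  have [a /Ap[i <-] [b /Ap[j <-] <-]] := XA _ xX.
  exists [set i; j]%SET => _; have [->|ij] := eqVneq i j.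
    by rewrite finset.setUid pt1 cards1 -[in RHS]mulr2n scaler_nat.
  rewrite pt2 cards2 ij // midpoint2 // scalerA divff // scale1r.
  by rewrite orbT.
have {rep} [g hg] := choice rep.
have injg : {in X &, injective g}.
  by move=> x y xX yX exy; rewrite -(hg x xX).1 exy (hg y yX).1.
pose G := [set e in map g X]%SET.
have cG : #|G| = k.
  rewrite cardsE -cX (card_uniqP _) ?size_map //.
  by rewrite map_inj_in_uniq ?fset_uniq.
have GP e : e \in G -> exists2 x, x \in X & e = g x.
  by rewrite inE => /mapP[x xX ->]; exists x.
pose E := [set e in G | #|e| == 2%N]%SET.
pose S := [set v | [set v]%SET \in G]%SET.
have graphE : is_graph E by move=> e; rewrite inE => /andP[_ /eqP].
have cvxA' : strictly_convex (range p).
  by apply: strictly_convex_sub cvxA => _ [i _ <-]; exact: pA.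
have cvxX' : strictly_convex (edge_midpoints p E `|` p @` [set` S]).
  have two0' : (2 : R)^-1 != 0 by rewrite invr_eq0.
  apply: strictly_convex_sub (strictly_convex_scale two0' cvxX).
  move=> _ [[e eE <-]|[v vS <-]].
    have e2 := graphE _ eE; move: eE; rewrite /= inE => /andP[/GP[x xX ex] _].
    by exists x => //; rewrite -(hg x xX).1 -ex pt2 // scalerA mulVf // scale1r.
  move: vS; rewrite /= inE => /GP[x xX ex].
  by exists x => //; rewrite -(hg x xX).1 -ex pt1 scalerA mulVf // scale1r.
exists E, S; split; last first.
  (* [G] is the disjoint union of [E] and the singletons of elements of [S]. *)
  rewrite -cG -(card_imset _ (@set1_inj 'I_n)) -cardsUI.
  rewrite [X in (_ + X)%N](_ : _ = 0)%N ?addn0; last first.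
    apply/eqP; rewrite cards_eq0; apply/eqP/setP => e; rewrite !inE.
    by apply/negP => /andP[/andP[_ /eqP e2] /imsetP[v _ ev]]; rewrite ev cards1 in e2.
  congr #|pred_of_set _|; apply/setP => e; rewrite !inE; apply/orP/idP.
    by case=> [/andP[]//|/imsetP[v]]; rewrite !inE => h ->.
  move=> eG; have [|x xX ex] := GP e; first by rewrite inE.
  have [_ /orP[/cards1P[v ev]|e2]] := hg x xX; last by left; rewrite eG ex.
  by right; apply/imsetP; exists v; rewrite ?inE -?ev -ex.
split=> //; exists p; split=> //; last first.
  by apply: strictly_convex_sub cvxX' => x; left.
split=> // [e e' eE e'E ee'|e v eE]; last first.
  exact: midpoint_neq_vertex (graphE _ eE).
have := pt2 _ (graphE _ eE); rewrite ee' -pt2; last exact: graphE.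
move: eE e'E; rewrite !inE => /andP[/mapP[x xX ->] _] /andP[/mapP[y yX ->] _].
by rewrite (hg x xX).1 (hg y yX).1 => ->.
Qed.

End Sumset.

Theorem theorem18 (R : realType) (n : nat) (hn : (3 <= n)%N) :
  ((3 * n) %/ 2 <= gtilde_ss R n <= 2 * n - 2)%N /\
  (exists N : nat,
     [/\ is_largest (convex_sumset_card R n) N, N = gtilde_ss R n
       & ((3 * n) %/ 2 <= N <= 2 * n - 2)%N]).
Proof.
have le_gtilde (E : {set {set 'I_n}}) (S : {set 'I_n}) :
    admissible R E S -> (#|E| + #|S| <= gtilde_ss R n)%N.
  move=> adm; apply: (@leq_bigmax_cond _ _ _ (E, S)).
  exact/asboolP.
have [E0 [S0 [adm0 card0]]] :
    exists E S, @admissible R n E S /\ (#|E| + #|S| = n + n./2)%N.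
  case: n hn {le_gtilde} => // m hm.
  by have [E [S h]] := cycle_odd_admissible R hm; exists E, S.
(* The polygon makes the family of admissible pairs nonempty, so the maximum is attained. *)
have [ES admES eES] : exists2 ES : {set {set 'I_n}} * {set 'I_n},
    admissible R ES.1 ES.2 & gtilde_ss R n = (#|ES.1| + #|ES.2|)%N.
  have [|ES /asboolP h e] := @eq_bigmax_cond _
    (fun ES : {set {set 'I_n}} * {set 'I_n} => `[< admissible R ES.1 ES.2 >])
    (fun ES => #|ES.1| + #|ES.2|)%N; last by exists ES.
  by apply/card_gt0P; exists (E0, S0); apply/asboolP.
have bounds : ((3 * n) %/ 2 <= gtilde_ss R n <= 2 * n - 2)%N.
  (* [n + n./2] equals [(3 * n) %/ 2]. *)
  apply/andP; split; first by have := le_gtilde _ _ adm0; lia.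
  rewrite eES; have [graphE [p [[injp _ _] cvxA _ cvxX]]] := admES.
  by apply: card_edges_vertices_le graphE injp cvxA cvxX _; lia.
split=> //; exists (gtilde_ss R n); split=> //; split.
  by rewrite eES; exact: admissible_sumset.
by move=> j /sumset_admissible[E [S [adm <-]]]; exact: le_gtilde.
Qed.
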